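(* There is no uniformly optimally reliable graph with $n=6$ vertices and $m=11$ edges, and there is no uniformly optimally reliable graph with $n=7$ vertices and $m=15$ edges.
   Context: Let $G(n,m)$ be the family of simple graphs with $n$ vertices and $m$ edges. For $G\in G(n,m)$ and $p\in(0,1)$, let $R(G,p)$ be the probability that the random spanning subgraph of $G$, which contains all vertices of $G$ and each edge of $G$ independently with probability $p$, is connected. A graph $G\in G(n,m)$ is uniformly optimally reliable (UOR) if $R(G,p)\ge R(H,p)$ for every $H\in G(n,m)$ and every $p\in(0,1)$. *)

(* Defs.v *)
From mathcomp Require Import all_boot all_order all_algebra.
From mathcomp Require Import reals.

Set Implicit Arguments.
Unset Strict Implicit.
Unset Printing Implicit Defensive.

Import GRing.Theory Num.Theory.

Local Open Scope ring_scope.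

(* A simple graph on the vertex set 'I_n is identified with its edge set, a set
   of two-element subsets of 'I_n.  Labelled graphs suffice to represent G(n,m),
   since isomorphic graphs have the same reliability. *)
Definition graphs (n m : nat) : {set {set {set 'I_n}}} :=
  [set E : {set {set 'I_n}} | [forall e in E, #|e| == 2%N] & #|E| == m].

(* For x = y, [set x; y] is a singleton, hence not an edge. *)
Definition adjacent (n : nat) (E : {set {set 'I_n}}) : rel 'I_n :=
  fun x y => [set x; y] \in E.

Definition connected_graph (n : nat) (E : {set {set 'I_n}}) : bool :=
  [forall x, forall y, connect (adjacent E) x y].

(* Probability that the random spanning subgraph of E has edge set exactly A,
   for A \subset E, when every edge is kept independently with probability p. *)
Definition subgraph_prob (R : realType) (n : nat) (E A : {set {set 'I_n}})
    (p : R) : R :=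
  \prod_(e in E) (if e \in A then p else 1 - p).

Definition reliability (R : realType) (n : nat) (E : {set {set 'I_n}})
    (p : R) : R :=
  \sum_(A in powerset E | connected_graph A) subgraph_prob E A p.

Definition uniformly_optimally_reliable (R : realType) (n m : nat)
    (G : {set {set 'I_n}}) : Prop :=
  G \in graphs n m /\
  forall H : {set {set 'I_n}}, H \in graphs n m ->
  forall p : R, 0 < p < 1 -> reliability H p <= reliability G p.
Arguments uniformly_optimally_reliable : clear implicits.

(* Main.v *)
From Stdlib Require Import NArith.
Require Import Defs.
From mathcomp Require Import all_boot all_order all_algebra.
From mathcomp Require Import reals.
From mathcomp Require Import fingroup perm.
From mathcomp Require Import ring.

(* Two values of p suffice in each case.  For (6, 11), the complement of
   P4 + K2 beats every other graph at p = 1/2, but at p = 1/4 it is beaten by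
   the complement of P3 + P3.  For (7, 15), the complement of C5 + K2 beats
   every other graph at p = 9/10, but at p = 1/2 it is beaten by the complement
   of P4 + C3.  The complements have only 4, respectively 6, edges: they are
   enumerated up to isomorphism by adding one edge at a time, and reliabilities
   are computed by deletion-contraction. *)

Set Implicit Arguments.
Unset Strict Implicit.
Unset Printing Implicit Defensive.

Import Order.TTheory GRing.Theory Num.Theory.

Local Open Scope nat_scope.

(** * Executable graphs, isomorphism test and enumeration *)

Definition pairs (n : nat) : seq (nat * nat) :=
  [seq (i, j) | i <- iota 0 n, j <- iota i.+1 (n - i.+1)].

Definition co_edges (n : nat) (l : seq (nat * nat)) : seq (nat * nat) :=
  [seq e <- pairs n | e \notin l].

Definition contract (lab : seq nat) (x y : nat) : seq nat :=
  [seq if c == nth 0 lab y then nth 0 lab x else c | c <- lab].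

(* Deletion-contraction: [lab] gives the same label to the vertices already
   joined, and for p = a / (a + b) the reliability is multiplied by the power
   (a + b) ^ (size es), so that it is an integer. *)
Fixpoint weight (a b : N) (es : seq (nat * nat)) (lab : seq nat) : N :=
  if es is (x, y) :: es' then
    if constant lab then iter (size es) (N.mul (N.add a b)) 1%num
    else if nth 0 lab x == nth 0 lab y
      then N.mul (N.add a b) (weight a b es' lab)
    else N.add (N.mul a (weight a b es' (contract lab x y)))
               (N.mul b (weight a b es' lab))
  else if constant lab then 1%num else 0%num.

Definition joined (l : seq (nat * nat)) (i j : nat) : bool :=
  ((i, j) \in l) || ((j, i) \in l).

(** An isomorphism invariant of vertices that prunes the search. Squaring can separate
    neighbourhoods with equal degree sums. *)
Definition color (n : nat) (l : seq (nat * nat)) (i : nat) : nat :=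
  let deg j := count (joined l j) (iota 0 n) in
  sumn [seq deg j ^ 2 | j <- iota 0 n & joined l i j].

Definition colors (n : nat) (l : seq (nat * nat)) : seq nat :=
  [seq color n l i | i <- iota 0 n].

(* Backtracking search.  Here and below, [if] and [find] replace [&&] and [has]
   where call-by-value evaluation of both arguments would be costly. *)
Fixpoint embedding (l l' : seq (nat * nat)) (c c' im : seq nat) : seq nat :=
  if c is d :: c0 then
    let k := size im in
    (fix try (vs : seq nat) : seq nat :=
       if vs is v :: vs' then
         if nth 0 c' v == d then
           if (v \notin im)
              && all (fun i => joined l k i == joined l' v (nth 0 im i))
                     (iota 0 k)
           then if embedding l l' c0 c' (rcons im v) is w :: s then w :: s
                else try vs'
           else try vs'
         else try vs'
       else [::]) (iota 0 (size c'))
  else im.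

Definition relabel (im : seq nat) (l : seq (nat * nat)) : seq (nat * nat) :=
  [seq (minn (nth 0 im e.1) (nth 0 im e.2), maxn (nth 0 im e.1) (nth 0 im e.2))
  | e <- l].

(* The search result is checked, so that nothing need be proved about
   [embedding] and [color].  The test on colors only saves time. *)
Definition isomorphic (n : nat) (a b : seq (nat * nat) * seq nat) : bool :=
  if sort leq a.2 == sort leq b.2 then
    let im := embedding a.1 b.1 a.2 b.2 [::] in
    [&& perm_eq im (iota 0 n), all (fun e => (e.1 < n) && (e.2 < n)) a.1
      & perm_eq (relabel im a.1) b.1]
  else false.

(** Colors travel with each list, so that they are computed once per graph and not at each
    comparison. *)
Definition add_class (n : nat) (l : seq (nat * nat))
    (acc : seq (seq (nat * nat) * seq nat)) :=
  let a := (l, colors n l) in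
  if find (isomorphic n a) acc < size acc then acc else a :: acc.

Fixpoint graph_classes (n k : nat) : seq (seq (nat * nat) * seq nat) :=
  if k is k'.+1 then
    foldr (add_class n) [::]
      [seq e :: a.1 | a <- graph_classes n k', e <- co_edges n a.1]
  else [:: ([::], colors n [::])].

Definition weight_co (n : nat) (p : N * N) (l : seq (nat * nat)) : N :=
  weight p.1 p.2 (co_edges n l) (iota 0 n).

(* [h1] and [h2] list the edges missing from the two competing graphs. *)
Definition no_optimum (n k : nat) (p1 p2 : N * N) (h1 h2 : seq (nat * nat)) :=
  let w1 := weight_co n p1 h1 in
  let w2 := weight_co n p2 h2 in
  all (fun a => if N.ltb (weight_co n p1 a.1) w1 then true
                else N.ltb (weight_co n p2 a.1) w2) (graph_classes n k).

(** The successor gives [inord] a default vertex. Only numbers below [n.+1] denote themselves, hence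
    the range conditions later on. *)
Definition edge (n : nat) (e : nat * nat) : {set 'I_n.+1} :=
  [set inord e.1; inord e.2].

Definition edges (n : nat) (l : seq (nat * nat)) : {set {set 'I_n.+1}} :=
  [set:: map (@edge n) l].

Definition permute (n : nat) (s : {perm 'I_n}) (E : {set {set 'I_n}}) :=
  (fun e : {set 'I_n} => s @: e) @: E.

(** * Connectivity under edge insertion and vertex permutation *)

Section Connectivity.

Variable n : nat.
Implicit Types (A B E : {set {set 'I_n}}) (s : {perm 'I_n}).

Lemma adjacent_sym E : symmetric (adjacent E).
Proof. by move=> x y; rewrite /adjacent setUC. Qed.

Lemma connect_adjacent_sym E : connect_sym (adjacent E).
Proof. exact/sym_connect_sym/adjacent_sym. Qed.

Lemma connect_adjacentS A B x y : A \subset B ->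
  connect (adjacent A) x y -> connect (adjacent B) x y.
Proof.
move=> /subsetP AB; apply: connect_sub => u v uv; apply/connect1; exact: AB.
Qed.

Lemma connected_graphS A B :
  A \subset B -> connected_graph A -> connected_graph B.
Proof.
move=> AB /forallP cA; apply/forallP => x; apply/forallP => y.
by apply: connect_adjacentS AB _; apply/forallP: y; apply: cA.
Qed.

(** A walk through the new edge can be shortened to cross it once, in one of its two directions. *)
Lemma connect_setU1 E (x y : 'I_n) u v :
  connect (adjacent ([set x; y] |: E)) u v =
  [|| connect (adjacent E) u v,
      connect (adjacent E) u x && connect (adjacent E) y v
    | connect (adjacent E) u y && connect (adjacent E) x v].
Proof.
set c := connect (adjacent E).
have cS a b : c a b -> connect (adjacent ([set x; y] |: E)) a b.
  by apply: connect_adjacentS; apply: subsetUr.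
have cxy : connect (adjacent ([set x; y] |: E)) x y.
  by apply: connect1; rewrite /adjacent setU11.
apply/idP/idP => [|/or3P[/cS //||]]; last 2 first.
- case/andP => /cS ux /cS yv; exact: connect_trans (connect_trans ux cxy) yv.
- case/andP => /cS uy /cS xv; apply: connect_trans (connect_trans uy _) xv.
  by rewrite connect_adjacent_sym.
- case/connectP => p; elim/last_ind: p v => [|p w IHp] v /=.
    by move=> _ ->; rewrite /c connect0.
  rewrite rcons_path last_rcons => /andP[/IHp /(_ erefl) + lw] ->.
  set z := last u p in lw *; move: lw; rewrite /adjacent in_setU1.
  case/predU1P => [eq_zw|zw].
    (* Equal unordered pairs match in one of two orders; [z = w] covers the degenerate pair. *)
    have zw : (z = x /\ w = y) \/ (z = y /\ w = x) \/ z = w.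
      have : z \in [set x; y] by rewrite -eq_zw set21.
      have : w \in [set x; y] by rewrite -eq_zw set22.
      have : x \in [set z; w] by rewrite eq_zw set21.
      have : y \in [set z; w] by rewrite eq_zw set22.
      by rewrite !inE; do 4![case/orP => /eqP ?]; subst; auto.
    by case: zw => [[-> ->]|[[-> ->]|-> //]];
      case/or3P => [h|/andP[h _]|/andP[h _]]; rewrite h ?/c ?connect0 ?orbT.
  have cz a : c a z -> c a w.
    by move=> az; apply: connect_trans az _; apply: connect1.
  case/or3P => [/cz ->//|/andP[-> /cz ->]|/andP[-> /cz ->]]; by rewrite ?orbT.
Qed.

Lemma connected_graph_setU1 E (x y : 'I_n) :
  connect (adjacent E) x y ->
  connected_graph ([set x; y] |: E) = connected_graph E.
Proof.
move=> xy; apply: eq_forallb => u; apply: eq_forallb => v.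
rewrite connect_setU1; apply/or3P/idP => [|->]; last by constructor.
case=> // /andP[a b]; first exact: connect_trans (connect_trans a xy) b.
by apply: connect_trans (connect_trans a _) b; rewrite connect_adjacent_sym.
Qed.

Lemma adjacent_permute s E x y :
  adjacent (permute s E) (s x) (s y) = adjacent E x y.
Proof.
rewrite /adjacent; have -> : [set s x; s y] = s @: [set x; y].
  by rewrite imsetU1 imset_set1.
by rewrite mem_imset //; apply/imset_inj/perm_inj.
Qed.

Lemma permute1 E : permute 1%g E = E.
Proof.
rewrite /permute -[RHS]imset_id; apply: eq_imset => e.
by rewrite -[RHS]imset_id; apply: eq_imset => x; rewrite perm1.
Qed.

Lemma permuteM s t E : permute (s * t)%g E = permute t (permute s E).
Proof.
rewrite /permute -imset_comp; apply: eq_imset => e /=.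
by rewrite -imset_comp; apply: eq_imset => x; rewrite permM.
Qed.

Lemma permuteK s : cancel (permute s) (permute s^-1%g).
Proof. by move=> E; rewrite -permuteM mulgV permute1. Qed.

Lemma card_edge_permute s (e : {set 'I_n}) : #|s @: e| = #|e|.
Proof. exact/card_imset/perm_inj. Qed.

Lemma connected_permute s E : connected_graph (permute s E) = connected_graph E.
Proof.
have sub (t : {perm 'I_n}) F x y : connect (adjacent F) x y ->
    connect (adjacent (permute t F)) (t x) (t y).
  case/connectP => p; elim/last_ind: p y => [|p w IHp] y /=.
    by move=> _ ->; rewrite connect0.
  rewrite rcons_path last_rcons => /andP[/IHp /(_ erefl) c1 lw] ->.
  by apply: connect_trans c1 (connect1 _); rewrite adjacent_permute.
have imp (t : {perm 'I_n}) F :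
    connected_graph F -> connected_graph (permute t F).
  move=> /forallP cF; apply/forallP => x; apply/forallP => y.
  have /forallP /(_ ((t^-1)%g y)) := cF ((t^-1)%g x).
  by move/(sub t); rewrite !permKV.
by apply/idP/idP => [/(imp (s^-1)%g)|/imp //]; rewrite permuteK.
Qed.

End Connectivity.

(** * Invariance of reliability and deletion-contraction *)

Section Reliability.

Variables (R : realType) (n : nat).
Implicit Types (A B E : {set {set 'I_n}}) (s : {perm 'I_n}) (p : R).

Local Open Scope ring_scope.

Lemma permute_inj s : injective (permute s).
Proof. exact/imset_inj/imset_inj/perm_inj. Qed.

(** A vertex permutation acts bijectively on spanning subgraphs, preserving connectedness and,
    factor by factor, probability. *)
Lemma reliability_permute s E p : reliability (permute s E) p = reliability E p.
Proof.
have inj : injective (fun e : {set 'I_n} => s @: e).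
  exact/imset_inj/perm_inj.
rewrite /reliability (reindex_inj (@permute_inj s)).
apply: eq_big => [A|A _].
  rewrite connected_permute !powersetE; congr (_ && _).
  apply/idP/idP => [/subsetP sAE|]; last exact: imsetS.
  by apply/subsetP => e eA; rewrite -(mem_imset _ _ inj) sAE // mem_imset.
rewrite /subgraph_prob big_imset /=; last by move=> ? ? _ _; apply: inj.
by apply: eq_bigr => e _; rewrite mem_imset.
Qed.

(* Reliability of E when the edges of B are present with certainty. *)
Definition reliability_over E B p : R :=
  \sum_(A in powerset E | connected_graph (A :|: B)) subgraph_prob E A p.

Lemma reliability_over0 E p : reliability E p = reliability_over E set0 p.
Proof. by apply: eq_bigl => A; rewrite setU0. Qed.

Lemma reliability_over_set0 B p :
  reliability_over set0 B p = (connected_graph B)%:R.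
Proof.
rewrite /reliability_over powerset0; case: (boolP (connected_graph B)) => cB.
  rewrite (big_pred1 set0) ?/subgraph_prob ?big_set0 // => A.
  by rewrite inE /=; case: eqP => //= ->; rewrite set0U.
by rewrite big_pred0 // => A; rewrite inE; case: eqP => //= ->; rewrite set0U;
  apply: negbTE.
Qed.

(** Condition on [e]: if kept, it joins the certain edges, which amounts to contraction; otherwise
    it is deleted. *)
Lemma reliability_overU1 e E B p : e \notin E ->
  reliability_over (e |: E) B p =
  p * reliability_over E (e |: B) p + (1 - p) * reliability_over E B p.
Proof.
move=> eE; rewrite /reliability_over (bigID (fun A => e \in A)) /=.
congr (_ + _).
(* Subgraphs containing [e] correspond to subsets of [E] by removing [e]. *)
- rewrite (reindex_onto (fun A => e |: A) (fun A => A :\ e)) /=; last first.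
    by move=> A /andP[_ eA]; rewrite setD1K.
  rewrite big_distrr /=; apply: eq_big => [A|A].
    rewrite !powersetE setU11 andbT -setUCA setUA andbAC; congr (_ && _).
    apply/andP/idP => [[sA /eqP eqA]|sAE].
      apply/subsetP => f fA; have /subsetP/(_ f) := sA.
      rewrite !inE fA orbT => /(_ isT)/orP[/eqP ef|//].
      by move: fA; rewrite -eqA ef !inE eqxx.
    split; first exact: setUS.
    apply/eqP/setU1K; apply: contra eE; exact: (subsetP sAE).
  move=> /andP[/andP[/andP[sA _] _] /eqP eqA].
  rewrite /subgraph_prob big_setU1 //= setU11; congr (_ * _).
  apply: eq_bigr => f fE; rewrite !inE.
  by case: eqP fE eE => [-> ->|].
- rewrite big_distrr /=; apply: eq_big => [A|A].
    rewrite !powersetE andbAC; congr (_ && _).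
    apply/andP/idP => [[/subsetP sA eA]|sAE].
      apply/subsetP => f fA; have := sA f fA.
      by rewrite !inE; case: eqP fA eA => [-> ->|].
    split; first exact: subset_trans sAE (subsetUr _ _).
    by apply: contra eE; apply: (subsetP sAE).
  move=> /andP[_ /negbTE eA].
  by rewrite /subgraph_prob big_setU1 //= eA.
Qed.

(** Every subgraph counts, so this is the total probability; conditioning on one edge at a time
    reduces it to p + (1 - p) = 1. *)
Lemma reliability_over_connected E B p :
  connected_graph B -> reliability_over E B p = 1.
Proof.
have [k] := ubnP #|E|; elim: k E B => // k IHk E B leEk cB.
have [->|[e eE]] := set_0Vmem E; first by rewrite reliability_over_set0 cB.
have ltEk : (#|E :\ e| < k)%N by rewrite [#|E|](cardsD1 e) eE in leEk.
rewrite -(setD1K eE) reliability_overU1 ?setD11 // !IHk //; first by ring.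
exact: connected_graphS (subsetUr _ _) cB.
Qed.

(** Such an edge is a loop once [B] is contracted. *)
Lemma reliability_over_joined E B (x y : 'I_n) p :
  connect (adjacent B) x y ->
  reliability_over E ([set x; y] |: B) p = reliability_over E B p.
Proof.
move=> xy; apply: eq_bigl => A; rewrite setUCA connected_graph_setU1 //.
exact: connect_adjacentS (subsetUr _ _) xy.
Qed.

End Reliability.

(** * Correctness of the integer weight *)

Section Weight.

Variables (R : realType) (n : nat) (a b : N).

Definition labels (lab : seq nat) (B : {set {set 'I_n.+1}}) :=
  size lab = n.+1 /\
  forall x y, connect (adjacent B) x y = (nth 0 lab x == nth 0 lab y).

Lemma edges_cons e l : edges n (e :: l) = edge n e |: edges n l.
Proof. by apply/setP => f; rewrite !inE. Qed.

Lemma labels_iota : labels (iota 0 n.+1) set0.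
Proof.
split=> [|x y]; first exact: size_iota.
rewrite !nth_iota // !add0n; apply/idP/eqP => [|/val_inj->]; last first.
  exact: connect0.
by case/connectP => -[|z p] /= => [_ -> //|/andP[]]; rewrite /adjacent inE.
Qed.

Lemma labels_connected lab B : labels lab B -> connected_graph B = constant lab.
Proof.
case=> szl labP; apply/forallP/(constantP 0) => [cB|[c eqc] x].
  exists (nth 0 lab (ord0 : 'I_n.+1)); apply: (@eq_from_nth _ 0).
    by rewrite size_nseq.
  move=> i lti; rewrite nth_nseq lti; rewrite szl in lti.
  have /forallP/(_ ord0) := cB (Ordinal lti).
  by rewrite labP => /eqP.
by apply/forallP => y; rewrite labP eqc !nth_nseq szl !ltn_ord.
Qed.

(** Both sides become Boolean combinations of equalities among the labels of [u], [v], [x] and [y],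
    so a case analysis decides. *)
Lemma labels_contract lab B (x y : 'I_n.+1) :
  labels lab B -> labels (contract lab x y) ([set x; y] |: B).
Proof.
case=> szl labP; split=> [|u v]; first by rewrite size_map.
rewrite connect_setU1 !labP !(nth_map 0) ?szl //.
case: (nth 0 lab u =P nth 0 lab y) => ?;
  case: (nth 0 lab v =P nth 0 lab y) => ?;
  by repeat (case: eqP => /= ?); congruence.
Qed.

Local Notation phi x := ((N.to_nat x)%:R : R)%R.
Local Open Scope ring_scope.

Let phiD x y : phi (N.add x y) = phi x + phi y.
Proof. by rewrite Nnat.N2Nat.inj_add natrD. Qed.

Let phiM x y : phi (N.mul x y) = phi x * phi y.
Proof. by rewrite Nnat.N2Nat.inj_mul natrM. Qed.

(** Each branch of [weight] is one rule for [reliability_over], multiplied by a + b to clear the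
    denominators of p and 1 - p. Uniqueness keeps the head edge out of the tail, as
    deletion-contraction requires. *)
Lemma weightP es lab B : phi a + phi b != 0 -> labels lab B ->
  all (fun e => (e.1 < n.+1)%N && (e.2 < n.+1)%N) es ->
  uniq (map (edge n) es) ->
  phi (weight a b es lab) =
  reliability_over (edges n es) B (phi a / (phi a + phi b)) *
  (phi a + phi b) ^+ size es.
Proof.
move=> c0; elim: es lab B => [|[x y] es IHes] lab B labB.
  move=> _ _; have -> : edges n [::] = set0 by apply/setP=> e; rewrite !inE.
  rewrite reliability_over_set0 (labels_connected labB) mulr1 /=.
  by case: constant.
move=> /= /andP[/andP[ltx lty] /IHes{}IHes] /andP[xyes /IHes{}IHes].
rewrite edges_cons -(labels_connected labB); case: ifP => [cB|_].
  rewrite reliability_over_connected // mul1r exprS -!phiD.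
  rewrite phiM; congr (_ * _).
  by elim: (es) => //= _ s IHs; rewrite exprS phiM IHs.
have exy : edge n (x, y) \notin edges n es by rewrite inE.
have eqe : edge n (x, y) = [set Ordinal ltx; Ordinal lty].
  by congr [set _; _]; apply: val_inj; rewrite /= inordK.
rewrite eqe in exy *.
have labU := labels_contract (Ordinal ltx) (Ordinal lty) labB.
have xyP := labB.2 (Ordinal ltx) (Ordinal lty).
rewrite -[nth 0 lab x == _]xyP; set e := [set _; _] in exy labU *.
rewrite reliability_overU1 // exprS; case: ifP => [xy|_].
  (* For a loop the two terms carry the same reliability, with coefficients p and 1 - p. *)
  rewrite reliability_over_joined // phiM phiD (IHes _ _ labB); ring.
rewrite phiD !phiM (IHes _ _ labB) (IHes _ _ labU).
by field.
Qed.

End Weight.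

(** * Completeness of the enumeration up to isomorphism *)

Section Enumeration.

Variable n : nat.
Implicit Types (l : seq (nat * nat)) (s : {perm 'I_n.+1}).

Lemma mem_pairs m e : (e \in pairs m) = (e.1 < e.2 < m).
Proof.
apply/allpairsPdep/andP => [[i [j [+ + ->]]]|[lt12 lt2m]] /=.
  rewrite !mem_iota add0n /= => lti /andP[ltij]; rewrite subnKC //.
exists e.1, e.2; rewrite !mem_iota add0n lt12 (ltn_trans lt12 lt2m) /=.
rewrite subnKC ?(ltn_trans lt12 lt2m) ?lt2m //; split=> //.
exact: surjective_pairing.
Qed.

Lemma pairs_uniq m : uniq (pairs m).
Proof.
apply: allpairs_uniq_dep => [|i _|]; rewrite ?iota_uniq //.
by move=> [i j] [i' j'] _ _ [-> ->].
Qed.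

Lemma edge_inj : {in pairs n.+1 &, injective (edge n)}.
Proof.
move=> [x y] [z w]; rewrite !mem_pairs /= => /andP[xy yn] /andP[zw wn].
have xn := ltn_trans xy yn; have zn := ltn_trans zw wn.
move/setP => eqe.
have := eqe (inord x); have := eqe (inord y).
have := eqe (inord z); have := eqe (inord w).
rewrite !inE -!val_eqE /= !inordK // !eqxx /= ?orbT.
(* The crossed matching [x = w], [y = z] would give [x < y < x]. *)
by do 4!case: eqP => /= ?; subst; rewrite ?ltnn // in xy zw *;
  move: (ltn_trans xy zw); rewrite ltnn.
Qed.

Lemma mem_edges_pairs f : (f \in edges n (pairs n.+1)) = (#|f| == 2).
Proof.
rewrite inE; apply/mapP/cards2P => [[[x y]]|[x [y [xy ->]]]].
  rewrite mem_pairs /= => /andP[xy yn] ->; exists (inord x), (inord y).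
  by split; rewrite // -val_eqE /= !inordK ?(ltn_trans xy) // ltn_eqF.
have [lt|lt|/val_inj eq] := ltngtP x y; last by rewrite eq eqxx in xy.
  by exists (val x, val y); rewrite ?mem_pairs /= ?lt //= /edge !inord_val.
by exists (val y, val x); rewrite ?mem_pairs /= ?lt //= /edge !inord_val setUC.
Qed.

Lemma permute_pairs s : permute s (edges n (pairs n.+1)) = edges n (pairs n.+1).
Proof.
apply/eqP; rewrite eqEcard card_imset ?leqnn ?andbT; last first.
  exact/imset_inj/perm_inj.
apply/subsetP => _ /imsetP[f + ->]; rewrite !mem_edges_pairs.
by rewrite card_edge_permute.
Qed.

Lemma edges_co l : {subset l <= pairs n.+1} ->
  edges n (co_edges n.+1 l) = edges n (pairs n.+1) :\: edges n l.
Proof.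
move=> sl; apply/setP => f; rewrite !inE.
apply/mapP/andP => [[e + ->]|[fl /mapP[e ep eqf]]].
  rewrite mem_filter => /andP[el ep]; split; last exact: map_f.
  apply: contra el => /mapP[e' e'l /edge_inj-> //]; exact: sl.
exists e => //; rewrite mem_filter ep andbT; apply: contra fl => el.
by rewrite eqf map_f.
Qed.

(** The complete graph is invariant under permutations, so classifying the complements is enough. *)
Lemma permute_co s l : {subset l <= pairs n.+1} ->
  permute s (edges n (co_edges n.+1 l)) =
  edges n (pairs n.+1) :\: permute s (edges n l).
Proof.
move=> sl; rewrite edges_co // -{2}(permute_pairs s).
have inj : injective (fun e : {set 'I_n.+1} => s @: e).
  exact/imset_inj/perm_inj.
apply/setP => f; apply/imsetP/setDP => [[e /setDP[ep el] ->]|[]].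
  by rewrite !mem_imset.
case/imsetP=> e ep ->; rewrite mem_imset // => el.
by exists e; rewrite // inE el.
Qed.

Lemma relabel_permute im : perm_eq im (iota 0 n.+1) ->
  exists s, forall l, all (fun e => (e.1 < n.+1) && (e.2 < n.+1)) l ->
    edges n (relabel im l) = permute s (edges n l).
Proof.
move=> eqim; have szim : size im = n.+1 by rewrite (perm_size eqim) size_iota.
have im_lt i : i < n.+1 -> nth 0 im i < n.+1.
  move=> lti; have : nth 0 im i \in im by rewrite mem_nth ?szim.
  by rewrite (perm_mem eqim) mem_iota.
pose f (i : 'I_n.+1) := Ordinal (im_lt i (ltn_ord i)).
have f_inj : injective f.
  move=> i j /(congr1 val) /eqP /=.
  rewrite nth_uniq ?szim // => [/eqP/val_inj //|].
  by rewrite (perm_uniq eqim) iota_uniq.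
exists (perm f_inj); elim=> [_|[x y] l IHl /= /andP[/andP[ltx lty] /IHl{}IHl]].
  by apply/setP => e; rewrite inE; apply/esym/imsetP => -[g]; rewrite inE.
rewrite !edges_cons /permute imsetU1 -/(permute _ _) -IHl; congr (_ |: _).
rewrite /edge imsetU1 imset_set1 /= !permE.
have fE z : z < n.+1 -> f (inord z) = inord (nth 0 im z).
  by move=> ltz; apply: val_inj; rewrite /= !inordK ?im_lt.
(* [relabel] puts the smaller endpoint first; the set of endpoints ignores that order. *)
by rewrite !fE //; case: leqP => // _; rewrite setUC.
Qed.

Lemma isomorphic_permute (a b : seq (nat * nat) * seq nat) :
  isomorphic n.+1 a b -> exists s, edges n a.1 = permute s (edges n b.1).
Proof.
rewrite /isomorphic; case: ifP => // _ /and3P[/relabel_permute[s sP] va eqb].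
exists (s^-1)%g; rewrite -(permuteK s (edges n a.1)) -sP //; congr permute.
by apply/setP => f; rewrite !inE (perm_mem (perm_map _ eqb)).
Qed.

(** A list is dropped only when a checked isomorphism leads to a kept one. A missed isomorphism
    would merely leave a redundant representative. *)
Lemma foldr_add_class (ls : seq (seq (nat * nat))) l : l \in ls ->
  exists2 a, a \in foldr (add_class n.+1) [::] ls &
    exists s, edges n l = permute s (edges n a.1).
Proof.
elim: ls => //= l' ls IHls; rewrite inE /add_class.
set acc := foldr _ _ _ in IHls *; case/predU1P => [->|/IHls[a a_acc aP]].
  rewrite -has_find; case: ifP => [/hasP[a a_acc /isomorphic_permute]|_].
    by exists a.
  exists (l', colors n.+1 l'); first exact: mem_head.
  by exists 1%g; rewrite permute1.
by exists a => //; case: ifP => // _; rewrite inE a_acc orbT.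
Qed.

Lemma foldr_add_class_sub (ls : seq (seq (nat * nat))) a :
  a \in foldr (add_class n.+1) [::] ls -> a.1 \in ls.
Proof.
elim: ls => //= l ls IHls; rewrite [in X in X -> _]/add_class; case: ifP => _.
  by move/IHls; rewrite inE orbC => ->.
by case/predU1P => [-> |/IHls]; rewrite inE ?eqxx // orbC => ->.
Qed.

Lemma graph_classes_pairs k a :
  a \in graph_classes n.+1 k -> {subset a.1 <= pairs n.+1}.
Proof.
elim: k a => [|k IHk] a /=; first by rewrite inE => /eqP-> e.
move/foldr_add_class_sub/allpairsPdep => [b [e [/IHk sb + ->]]].
rewrite mem_filter => /andP[_ ep] f; rewrite inE => /predU1P[-> //|]; exact: sb.
Qed.

(** Delete an edge [f] of [C], take the representative of the rest by induction, and put back the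
    edge that corresponds to [f]. *)
Lemma graph_classes_complete k (C : {set {set 'I_n.+1}}) :
  C \subset edges n (pairs n.+1) -> #|C| = k ->
  exists2 a, a \in graph_classes n.+1 k & exists s, C = permute s (edges n a.1).
Proof.
elim: k C => [|k IHk] C sC.
  move/eqP; rewrite cards_eq0 => /eqP->; exists ([::], colors n.+1 [::]) => //=.
    by rewrite inE.
  exists 1%g; rewrite permute1; by apply/setP => e; rewrite !inE.
move=> cardC; have /card_gt0P[f fC] : 0 < #|C| by rewrite cardC.
have [||a aP [s eqC]] := IHk (C :\ f).
- exact: subset_trans (subsetDl _ _) sC.
- by move: cardC; rewrite (cardsD1 f) fC => -[].
(* Pulled back along [s], [f] is given by a pair [e] to append to the representative. *)
have : s^-1%g @: f \in edges n (pairs n.+1).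
  rewrite mem_edges_pairs card_edge_permute -mem_edges_pairs.
  exact: (subsetP sC).
rewrite inE => /mapP[e ep eqe].
have eqsf : s @: edge n e = f.
  rewrite -eqe -imset_comp -[RHS]imset_id.
  by apply: eq_imset => x /=; rewrite permKV.
have eqC' : C = permute s (edges n (e :: a.1)).
  by rewrite edges_cons /permute imsetU1 -/(permute _ _) -eqC eqsf setD1K.
(* Otherwise [f] would survive its own deletion; thus [e] is one of the extensions tried. *)
have ea : e \notin a.1.
  apply/negP => ea; have : f \in C :\ f; last by rewrite setD11.
  by rewrite eqC -eqsf imset_f // inE map_f.
have [|b bP [t eqt]] := @foldr_add_class
    [seq e :: a.1 | a <- graph_classes n.+1 k, e <- co_edges n.+1 a.1]
    (e :: a.1).
  by apply/allpairsPdep; exists a, e; rewrite mem_filter ea.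
by exists b => //; exists (t * s)%g; rewrite permuteM -eqt.
Qed.

End Enumeration.

(** * From the computed test to the absence of an optimal graph *)

Section NoOptimum.

Variables (R : realType) (n m k : nat).
Implicit Types (l h : seq (nat * nat)) (p : N * N).

Local Open Scope ring_scope.

Definition prob p : R :=
  (N.to_nat p.1)%:R / ((N.to_nat p.1)%:R + (N.to_nat p.2)%:R).

Definition positive p := (0 < N.to_nat p.1)%N && (0 < N.to_nat p.2)%N.

Lemma prob_itv p : positive p -> 0 < prob p < 1.
Proof.
case/andP=> p1 p2; rewrite /prob divr_gt0 ?addr_gt0 ?ltr0n //=.
by rewrite ltr_pdivrMr ?addr_gt0 ?ltr0n // mul1r ltrDl ltr0n.
Qed.

Lemma co_edges_uniq l : uniq (map (edge n) (co_edges n.+1 l)).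
Proof.
rewrite map_inj_in_uniq ?filter_uniq ?pairs_uniq // => e f.
by rewrite !mem_filter => /andP[_ ep] /andP[_ fp]; apply: edge_inj.
Qed.

Lemma card_co_edges l : #|edges n (co_edges n.+1 l)| = size (co_edges n.+1 l).
Proof.
by rewrite cardsE (card_uniqP _) ?co_edges_uniq // size_map.
Qed.

Lemma weight_coP p l : positive p ->
  (N.to_nat (weight_co n.+1 p l))%:R =
  reliability (edges n (co_edges n.+1 l)) (prob p) *
  ((N.to_nat p.1)%:R + (N.to_nat p.2)%:R) ^+ size (co_edges n.+1 l) :> R.
Proof.
move=> /andP[p1 p2]; rewrite reliability_over0; apply: weightP.
- by rewrite gt_eqF // addr_gt0 ?ltr0n.
- exact: labels_iota.
- apply/allP => e; rewrite mem_filter mem_pairs => /andP[_ /andP[lt12 lt2n]].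
  by rewrite lt2n (ltn_trans lt12).
- exact: co_edges_uniq.
Qed.

(** With equally many edges, both weights carry the same positive scaling factor, which cancels. *)
Lemma weight_co_lt p l h : positive p ->
  size (co_edges n.+1 l) = size (co_edges n.+1 h) ->
  N.ltb (weight_co n.+1 p l) (weight_co n.+1 p h) ->
  reliability (edges n (co_edges n.+1 l)) (prob p) <
  reliability (edges n (co_edges n.+1 h)) (prob p).
Proof.
move=> pp eqs /N.ltb_lt; rewrite /N.lt Nnat.N2Nat.inj_compare.
move=> /PeanoNat.Nat.compare_lt_iff/ssrnat.ltP.
rewrite -(ltr_nat R) !weight_coP // eqs ltr_pM2r //.
by case/andP: pp => p1 p2; rewrite exprn_gt0 // addr_gt0 ?ltr0n.
Qed.

(** The complement of an optimal graph has [k] edges, hence is isomorphic to an enumerated one.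
    Optimality forbids a strict loss to either competitor, while the test asserts one. *)
Lemma no_optimumP p1 p2 h1 h2 : size (pairs n.+1) = (m + k)%N ->
  size (co_edges n.+1 h1) = m -> size (co_edges n.+1 h2) = m ->
  positive p1 -> positive p2 -> no_optimum n.+1 k p1 p2 h1 h2 ->
  ~ exists G, uniformly_optimally_reliable R n.+1 m G.
Proof.
move=> szp sz1 sz2 pos1 pos2 /allP noopt [G [Gm Gopt]].
have /andP[/forallP G2 /eqP cardG] :
    [forall e in G, #|e| == 2%N] && (#|G| == m).
  by move: Gm; rewrite inE.
pose P := edges n (pairs n.+1).
have GP : G \subset P.
  by apply/subsetP => e; rewrite mem_edges_pairs; apply/implyP.
have cardP : #|P| = (m + k)%N.
  have eqp : co_edges n.+1 [::] = pairs n.+1 by apply: filter_predT.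
  by rewrite /P -eqp card_co_edges eqp.
have [||a aP [s eqC]] := @graph_classes_complete n k (P :\: G).
- exact: subsetDl.
- by rewrite cardsD (setIidPr GP) cardP cardG addKn.
have eqG : G = permute s (edges n (co_edges n.+1 a.1)).
  rewrite permute_co; last exact: graph_classes_pairs aP.
  by rewrite -eqC setDDr setDv set0U (setIidPr GP).
have sza : size (co_edges n.+1 a.1) = m.
  rewrite -card_co_edges -cardG eqG card_imset //; exact/imset_inj/perm_inj.
have beaten p h : positive p -> size (co_edges n.+1 h) = m ->
    ~~ N.ltb (weight_co n.+1 p a.1) (weight_co n.+1 p h).
  move=> pos szh; apply/negP => /(weight_co_lt pos).
  rewrite sza szh => /(_ erefl).
  apply/negP; rewrite -leNgt.
  rewrite -(reliability_permute s (edges n (co_edges n.+1 a.1))) -eqG.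
  apply: Gopt; last exact: prob_itv.
  rewrite inE card_co_edges szh eqxx andbT; apply/forallP => e; apply/implyP.
  rewrite -mem_edges_pairs !inE => /mapP[f + ->].
  by rewrite mem_filter => /andP[_ fp]; apply: map_f.
have := noopt a aP.
by rewrite (negbTE (beaten _ _ pos1 sz1)) (negbTE (beaten _ _ pos2 sz2)).
Qed.

End NoOptimum.

(** The pairs stand for p = 1/2 and p = 1/4; the lists are P4 + K2 and P3 + P3. *)
Lemma no_optimum_6_11 :
  no_optimum 6 4 (1, 1)%num (1, 3)%num
    [:: (0, 1); (0, 2); (1, 3); (4, 5)] [:: (0, 1); (0, 2); (3, 4); (3, 5)].
Proof. by vm_compute. Qed.

(** The pairs stand for p = 9/10 and p = 1/2; the lists are C5 + K2 and P4 + C3. *)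
Lemma no_optimum_7_15 :
  no_optimum 7 6 (9, 1)%num (1, 1)%num
    [:: (0, 1); (0, 2); (1, 3); (2, 4); (3, 4); (5, 6)]
    [:: (0, 1); (0, 2); (1, 2); (3, 4); (3, 5); (4, 6)].
Proof. by vm_compute. Qed.

Theorem mainTheorem6 (R : realType) :
  ~ (exists G : {set {set 'I_6}}, uniformly_optimally_reliable R 6 11 G) /\
  ~ (exists G : {set {set 'I_7}}, uniformly_optimally_reliable R 7 15 G).
Proof.
split.
(* The complete graphs have 15 = 11 + 4 and 21 = 15 + 6 edges, so 4 and 6 are missing. *)
- by apply: (@no_optimumP _ 5 11 4 _ _ _ _ _ _ _ _ _ no_optimum_6_11).
- by apply: (@no_optimumP _ 6 15 6 _ _ _ _ _ _ _ _ _ no_optimum_7_15).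
Qed.
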